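(* Every prime interval order with no infinite antichain is at most countable and scattered.
   Context: A poset is an interval order if it is isomorphic to a set of nonempty intervals of some chain, ordered by $I<J$ iff $x<y$ for all $x\in I$, $y\in J$. A module of a poset $(V,\le)$ is a subset $A\subseteq V$ such that for all $a,a'\in A$ and $x\notin A$: $x\le a\iff x\le a'$ and $a\le x\iff a'\le x$. The empty set, singletons and $V$ are trivial modules; the poset is prime if it has no nontrivial module. A poset is scattered if it does not embed the chain $\mathbb{Q}$ of rationals. *)

(* Defs.v *)
From mathcomp Require Import all_boot all_order all_algebra.
From mathcomp Require Import all_classical.

Set Implicit Arguments.
Unset Strict Implicit.
Unset Printing Implicit Defensive.

Import Order.Theory.

Local Open Scope classical_set_scope.
Local Open Scope order_scope.

Definition order_convex d (C : porderType d) (I : set C) : Prop :=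
  forall x y z, I x -> I y -> x <= z -> z <= y -> I z.

Definition nonempty_interval d (C : porderType d) (I : set C) : Prop :=
  I !=set0 /\ order_convex I.

Definition interval_lt d (C : porderType d) (I J : set C) : Prop :=
  forall x y, I x -> J y -> x < y.

(* Injectivity of [f] makes it an isomorphism onto a *set* of intervals, whose
   order is [I = J \/ interval_lt I J]. *)
Definition interval_order d (T : porderType d) : Prop :=
  exists (d' : Order.disp_t) (C : orderType d') (f : T -> set C),
    [/\ injective f,
        forall x, nonempty_interval (f x)
      & forall x y, x < y <-> interval_lt (f x) (f y)].

Definition module d (T : porderType d) (A : set T) : Prop :=
  forall a a' x, A a -> A a' -> ~ A x ->
    (x <= a <-> x <= a') /\ (a <= x <-> a' <= x).

Definition trivial_module d (T : porderType d) (A : set T) : Prop :=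
  [\/ A = set0, exists x, A = [set x] | A = setT].

Definition prime_poset d (T : porderType d) : Prop :=
  forall A : set T, module A -> trivial_module A.

Definition antichain d (T : porderType d) (A : set T) : Prop :=
  forall x y, A x -> A y -> x >=< y -> x = y.

Definition scattered d (T : porderType d) : Prop :=
  ~ exists f : rat -> T, {mono f : x y / x <= y}.

(* Main.v *)
(* Let [F] be a finite antichain, [S] the set of elements incomparable to all of
   [F], and split [S] into connected components of its incomparability graph.
   An element outside [S] and [F] that is incomparable to some [a] in [S] forces
   [a] to be minimal or maximal in [S], because the order is (2+2)-free.  Hence
   the components that contain neither a minimal, nor a maximal, nor a fixed
   element [y] of [S] make up two modules, those below [y] and those above [y],
   with at most one element each by primality.
   So if [S] is large (uncountable, resp. containing a densely ordered subset),
   then one of at most three components is large; being connected, it has an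
   element [p] such that the elements of [S] incomparable to [p] still form a
   large set.  Adding [p] to [F] and iterating yields an infinite antichain. *)
Require Import Defs.
From mathcomp Require Import all_boot all_order all_algebra.
From mathcomp Require Import all_classical.

Set Implicit Arguments.
Unset Strict Implicit.
Unset Printing Implicit Defensive.

Local Open Scope classical_set_scope.
Local Open Scope order_scope.

Import Order.TTheory GRing.Theory Num.Theory.

(** * Components of the incomparability graph, and modules built from them *)

Section IncomparabilityComponents.
Context {d : Order.disp_t} {T : porderType d}.
Implicit Types (S A : set T) (l : seq T).

Lemma order_cases (x y : T) : [\/ x = y, x < y, y < x | x >< y].
Proof.
case: (boolP (x >=< y)) => [/comparable_ltgtP[]|]; by constructor.
Qed.

(** If both conclusions failed, the intervals would contain points with [u < t <= s < v <= u]. *)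
Lemma interval_order_2p2_free : interval_order T ->
  forall a b x y : T, a < b -> x < y -> a < y \/ x < b.
Proof.
move=> [d' [C [f [_ _ fE]]]] a b x y ab xy.
apply: contrapT => /not_orP[/fE nay /fE nxb].
have [u [v [fu fv vu]]] : exists u v, [/\ f a u, f y v & v <= u].
  apply: contrapT => h; apply: nay => u v fu fv.
  by rewrite ltNge; apply/negP => vu; apply: h; exists u, v.
have [s [t [fs ft ts]]] : exists s t, [/\ f x s, f b t & t <= s].
  apply: contrapT => h; apply: nxb => s t fs ft.
  by rewrite ltNge; apply/negP => ts; apply: h; exists s, t.
have ut : u < t by move/fE: ab => /(_ u t fu ft).
have sv : s < v by move/fE: xy => /(_ s v fs fv).
by have := lt_le_trans (lt_trans (lt_le_trans ut ts) sv) vu; rewrite ltxx.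
Qed.

(** This is the connected component of [x] in the incomparability graph on [S]; it is empty when [x]
    is not in [S]. *)
Inductive conn S (x : T) : set T :=
| conn_refl : S x -> conn S x x
| conn_step y z : conn S x y -> S z -> y >< z -> conn S x z.

Lemma conn_sub S x z : conn S x z -> S z.
Proof. by case. Qed.

Lemma conn_base S x z : conn S x z -> S x.
Proof. by elim. Qed.

Lemma conn_or_lt S x z : S x -> S z -> conn S x z \/ x < z \/ z < x.
Proof.
move=> Sx Sz; case: (order_cases x z) => [<-|||xz]; [|by right; left|by right; right|].
- by left; apply: conn_refl.
- by left; apply: conn_step xz => //; apply: conn_refl.
Qed.

(** Every vertex of a path from [e] is comparable to [a], and one edge cannot cross from one side of
    [a] to the other: by transitivity its ends would be comparable. *)
Lemma conn_same_side S e x a : conn S e x -> ~ conn S e a -> S a ->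
  (e < a -> x < a) /\ (a < e -> a < x).
Proof.
move=> ex nea Sa; elim: ex => [//|y z ey [IH1 IH2] Sz yz].
have ez : conn S e z by apply: conn_step yz.
have := incomparable_ltF yz; have : (z < y) = false.
  by apply: incomparable_ltF; rewrite comparable_sym.
move=> nzy nyz.
case: (order_cases z a) => [za|za|az|za].
- by case: nea; rewrite -za.
- split=> // ae; exfalso; move/IH2: ae => ay.
  by have := lt_trans za ay; rewrite nzy.
- split=> // ea; exfalso; move/IH1: ea => ya.
  by have := lt_trans ya az; rewrite nyz.
- by case: nea; apply: conn_step za.
Qed.

Definition incomparable_to l : set T := [set z | forall p, p \in l -> z >< p].

Hypothesis T22 : forall a b x y : T, a < b -> x < y -> a < y \/ x < b.

(** Some [p] in [l] is comparable to [x]. If [x] were incomparable to [a], then [T22] would fail for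
    [b < a] and [x < p], or for [a < c] and [p < x]. *)
Lemma comparable_inside l a b c x :
  incomparable_to l a -> incomparable_to l b -> incomparable_to l c ->
  b < a -> a < c -> x \notin l -> ~ incomparable_to l x -> x >=< a.
Proof.
move=> Sa Sb Sc ba ac xl /existsNP[p /not_implyP[pl /negP]]; rewrite negbK => xp.
have xDp : x != p by apply: contraNneq xl => ->.
apply/negPn/negP => xa.
have [xlt|plt] : x < p \/ p < x.
  by move: xDp; case: (comparable_ltgtP xp) => //; [left|right].
- have [bp|] := T22 ba xlt; first by have := incomparable_ltF (Sb _ pl); rewrite bp.
  by rewrite (incomparable_ltF xa).
- have [ax|pc] := T22 ac plt.
    by move: xa; rewrite comparable_sym => /incomparable_ltF; rewrite ax.
  by have := Sc _ pl; rewrite comparable_sym => /incomparable_ltF; rewrite pc.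
Qed.

Lemma module_of_sides l A : A `<=` incomparable_to l ->
  (forall a, A a -> exists2 b, incomparable_to l b & b < a) ->
  (forall a, A a -> exists2 c, incomparable_to l c & a < c) ->
  (forall x, incomparable_to l x -> ~ A x ->
     (forall a, A a -> x < a) \/ (forall a, A a -> a < x)) ->
  module A.
Proof.
move=> AS Amin Amax side.
have compA x : x \notin l -> ~ incomparable_to l x -> forall a, A a -> x >=< a.
  move=> xl Sx a Aa; have [b Sb ba] := Amin _ Aa; have [c Sc ac] := Amax _ Aa.
  by apply: (@comparable_inside l a b c) => //; apply: AS.
have {}side x : ~ A x -> x \in l \/
    (forall a, A a -> x < a) \/ (forall a, A a -> a < x).
  move=> nAx; have [xl|xl] := boolP (x \in l); first by left.
  (* In the remaining case [x] is comparable to some [p] in [l] and, by [compA], to all of [A]. As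
     [p] is incomparable to [A], transitivity puts all of [A] on the same side of [x] as [p]. *)
  right; have [Sx|Sx] := EM (incomparable_to l x); first exact: side.
  move: (Sx) => /existsNP[p /not_implyP[pl /negP]]; rewrite negbK => xp.
  have xDp : x != p by apply: contraNneq xl => ->.
  have nltp a : A a -> (a < p = false) * (p < a = false).
    move=> /AS/(_ _ pl) ap; split; first exact: incomparable_ltF.
    by apply: incomparable_ltF; rewrite comparable_sym.
  have [xlt|plt] : x < p \/ p < x.
    by move: xDp; case: (comparable_ltgtP xp) => //; [left|right].
  - left=> a Aa; case: (comparable_ltgtP (compA x xl Sx a Aa)) => // [ax|xa].
      by have := lt_trans ax xlt; rewrite nltp.
    by move: xlt; rewrite xa nltp.
  - right=> a Aa; case: (comparable_ltgtP (compA x xl Sx a Aa)) => // [xa|xa].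
      by have := lt_trans plt xa; rewrite nltp.
    by move: plt; rewrite xa nltp.
move=> a a' x Aa Aa' nAx; have [xl|[xlt|ltx]] := side x nAx.
- have inc b : A b -> (x <= b = false) * (b <= x = false).
    move=> /AS/(_ _ xl) bx; split; last exact: incomparable_leF.
    by apply: incomparable_leF; rewrite comparable_sym.
  by rewrite !inc.
- by rewrite !(ltW (xlt _ _)) // !(lt_geF (xlt _ _)).
- by rewrite !(ltW (ltx _ _)) // !(lt_geF (ltx _ _)).
Qed.

Definition same_side (up : bool) (y z : T) := if up then y < z else z < y.

(** An element of [S] outside [A] lies in the component of [b], [c] or [y], or on the other side of
    [y]; in each case all of [A] is on one side of it. The alternatives [b = y] and [c = y] serve
    when [S] has no minimal or no maximal element. *)
Lemma module_of_components l (S := incomparable_to l) b c y (up : bool)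
    (A := [set z | [/\ S z, same_side up y z, ~ conn S b z, ~ conn S c z
                     & ~ conn S y z]]) :
  S b -> S c -> S y ->
  (forall z, S z -> ~ conn S b z -> exists2 t, S t & t < z) ->
  (forall z, S z -> ~ conn S c z -> exists2 t, S t & z < t) ->
  b = y \/ (forall z, S z -> ~ (z < b)) ->
  c = y \/ (forall z, S z -> ~ (c < z)) ->
  module A.
Proof.
move=> Sb Sc Sy bmin cmax yb yc.
apply: (@module_of_sides l).
- by move=> z [].
- by move=> a [Sa _ nb _ _]; apply: bmin.
- by move=> a [Sa _ _ nc _]; apply: cmax.
move=> x Sx nAx.
have ySide x' : conn S y x' \/ x' = y ->
    (forall a, A a -> x' < a) \/ (forall a, A a -> a < x').
  move=> yx'.
  have cyx : conn S y x' by case: yx' => [//|->]; apply: conn_refl.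
  rewrite /A; case: up {A nAx yx'} => /=; [left|right] => a [Sa ya _ _ ny];
  by have [] := conn_same_side cyx ny Sa; auto.
have [yx|nyx] := EM (conn S y x); first by apply: ySide; left.
have [bx|nbx] := EM (conn S b x).
  case: yb => [by_|minb]; first by apply: ySide; left; rewrite -by_.
  left=> a [Sa _ nba _ _]; have [h _] := conn_same_side bx nba Sa; apply: h.
  by have [//|[//|ab]] := conn_or_lt Sb Sa; case: (minb a).
have [cx|ncx] := EM (conn S c x).
  case: yc => [cy|maxc]; first by apply: ySide; left; rewrite -cy.
  right=> a [Sa _ _ nca _]; have [_ h] := conn_same_side cx nca Sa; apply: h.
  by have [//|[ca|//]] := conn_or_lt Sc Sa; case: (maxc a).
have nsx : ~ same_side up y x by move=> h; apply: nAx.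
(* Now [x] is on the side of [y] opposite to [A], so [y] separates them. *)
have [//|yx] := conn_or_lt Sy Sx.
rewrite /A; case: up nsx {A nAx ySide} => /= nsx; [left|right] => a [_ ya _ _ _].
- by case: yx => // xy; apply: lt_trans ya.
- by case: yx => // xy; apply: lt_trans xy.
Qed.

(** * Infinite antichains from an abstract notion of large set *)

Variable large : set T -> Prop.
(** The sets that are not large form an ideal containing the singletons. The two instances are
    uncountability and containing a densely ordered subset. *)
Hypothesis large_sub : forall A B, A `<=` B -> large A -> large B.
Hypothesis largeU : forall A B, large (A `|` B) -> large A \/ large B.
Hypothesis large0 : ~ large set0.
Hypothesis large1 : forall x, ~ large [set x].
Hypothesis large_conn : forall S y,
  large (conn S y) -> exists2 p, S p & large (S `&` [set z | z >< p]).

Hypothesis prime : prime_poset T.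

Lemma large_extend l : large (incomparable_to l) ->
  exists2 p, incomparable_to l p & large (incomparable_to (p :: l)).
Proof.
set S := incomparable_to l => lS.
have [y Sy] : exists y, S y.
  apply: contrapT => /forallNP S0; apply: large0.
  by apply: large_sub lS => z /S0.
(* Take a minimal element of [S] if there is one: whatever is outside its component lies above it.
   Otherwise take [y], since then every element of [S] has another one below it. *)
have [b [Sb bmin yb]] : exists b, [/\ S b,
    forall z, S z -> ~ conn S b z -> exists2 t, S t & t < z &
    b = y \/ (forall z, S z -> ~ (z < b))].
  have [[b Sb minb]|nmin] := EM (exists2 b, S b & forall z, S z -> ~ (z < b)).
    exists b; split=> [//|z Sz nbz|]; last by right.
    by exists b => //; have [//|[//|/minb]] := conn_or_lt Sb Sz; case.
  exists y; split=> [//|z Sz _|]; last by left.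
  apply: contrapT => h; apply: nmin; exists z => // t St tz.
  by apply: h; exists t.
have [c [Sc cmax yc]] : exists c, [/\ S c,
    forall z, S z -> ~ conn S c z -> exists2 t, S t & z < t &
    c = y \/ (forall z, S z -> ~ (c < z))].
  have [[c Sc maxc]|nmax] := EM (exists2 c, S c & forall z, S z -> ~ (c < z)).
    exists c; split=> [//|z Sz ncz|]; last by right.
    by exists c => //; have [//|[/maxc|//]] := conn_or_lt Sc Sz; case.
  exists y; split=> [//|z Sz _|]; last by left.
  apply: contrapT => h; apply: nmax; exists z => // t St tz.
  by apply: h; exists t.
pose A up := [set z | [/\ S z, same_side up y z, ~ conn S b z, ~ conn S c z
                     & ~ conn S y z]].
(* Primality makes [A up] empty or a singleton; it is not everything, as it omits [y]. *)
have smallA up : ~ large (A up).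
  have Am : module (A up) by apply: module_of_components.
  case: (prime Am) => [A0|[x ->]|AT]; [|exact: large1|].
  - by rewrite A0.
  - have [_ _ _ _ nyy] : A up y by rewrite AT.
    by case: nyy; apply: conn_refl.
have [e Se] : exists e, large (conn S e).
  have cover : S `<=` conn S b `|` (conn S c `|` (conn S y `|` (A true `|` A false))).
    move=> z Sz.
    have [|nb] := EM (conn S b z); first by left.
    have [|nc] := EM (conn S c z); first by right; left.
    have [|ny] := EM (conn S y z); first by right; right; left.
    by right; right; right; have [//|[yz|yz]] := conn_or_lt Sy Sz; [left|right].
  case/largeU: (large_sub cover lS) => [lb|/largeU[lc|/largeU[ly|/largeU[]]]].
  - by exists b.
  - by exists c.
  - by exists y.
  - by move/smallA.
  - by move/smallA.
have [p Sp lp] := large_conn Se; exists p => //.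
by apply: large_sub lp => z [Sz zp] q; rewrite inE => /predU1P[->|/Sz].
Qed.

Lemma infinite_antichain : large setT ->
  exists A : set T, antichain A /\ ~ finite_set A.
Proof.
move=> lT; have [x0 _] : exists x : T, True.
  apply: contrapT => /forallNP T0; apply: large0.
  by apply: large_sub lT => z _; have := T0 z.
have /choice[g gP] : forall l, exists p, large (incomparable_to l) ->
    incomparable_to l p /\ large (incomparable_to (p :: l)).
  move=> l; have [/large_extend[p]|nl] := EM (large (incomparable_to l)).
    by exists p.
  (* [x0] is a default value, for lists [l] whose [incomparable_to l] is not large. *)
  by exists x0.
(* [s n] lists the first [n] chosen elements, and [g (s n)] is the next one. *)
pose s n := iter n (fun l => g l :: l) [::].
have sP n : large (incomparable_to (s n)).
  by elim: n => [|n /gP[]//]; apply: large_sub lT => z _ p.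
have gs m n : (m < n)%N -> g (s m) \in s n.
  elim: n => [//|n IH]; rewrite ltnS leq_eqVlt inE => /predU1P[->|/IH ->].
    by rewrite eqxx.
  by rewrite orbT.
have inc m n : (m < n)%N -> g (s n) >< g (s m).
  by move=> /gs; have [+ _] := gP _ (sP n); apply.
have inc' m n : m <> n -> ~~ (g (s n) >=< g (s m)).
  case: (ltngtP m n) => [/inc //|/inc|//] => + _.
  by rewrite comparable_sym.
exists (range (g \o s)); split.
  move=> _ _ [m _ <-] [n _ <-] /= mn; have [->//|] := EM (n = m).
  by move/inc'; rewrite mn.
(* A repeated value would be incomparable to itself. *)
have ginj : injective (g \o s).
  by move=> m n /= mn; apply: contrapT => /inc'; rewrite mn comparablexx.
move=> /(finite_preimage (in2W ginj)); rewrite preimage_range.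
exact: infinite_nat.
Qed.

End IncomparabilityComponents.

(** * Uncountability as a notion of large set *)

Section Uncountable.
Context {d : Order.disp_t} {T : porderType d}.

Lemma uncountable_conn (S : set T) y : ~ countable (conn S y) ->
  exists2 p, S p & ~ countable (S `&` [set z | z >< p]).
Proof.
move=> nc; apply: contrapT => h; apply: nc.
have hc p : S p -> countable (S `&` [set z | z >< p]).
  by move=> Sp; apply: contrapT => nc; apply: h; exists p.
(* [ball n] holds the ends of walks of exactly [n] steps from [y]. Intersecting with [S] lets [hc]
   bound each step, so the component is a countable union of countable sets. *)
pose ball := fix ball n := if n is m.+1 then
  \bigcup_(p in ball m `&` S) (S `&` [set z | z >< p]) else [set y].
have cb n : countable (ball n).
  elim: n => [|n IH]; first exact: countable1.
  apply: bigcup_countable; last by move=> p [_ /hc].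
  by apply: sub_countable IH; apply: subset_card_le => z [].
have : countable (\bigcup_n ball n) by apply: bigcup_countable.
apply: sub_countable; apply: subset_card_le => z.
elim=> [Sy|u v yu [n _ bn] Sv uv]; first by exists 0%N.
exists n.+1 => //; exists u; first by split=> //; apply: conn_sub yu.
by split=> //=; rewrite comparable_sym.
Qed.

End Uncountable.

(** * Containing a densely ordered subset as a notion of large set *)

Section DenselyOrdered.
Context {d : Order.disp_t} {T : porderType d}.

(** [X] may be any subposet, not only a chain: density concerns its comparable pairs, of which there
    is at least one. *)
Definition densely_ordered (X : set T) :=
  (exists a b, [/\ X a, X b & a < b]) /\
  forall a b, X a -> X b -> a < b -> exists c, [/\ X c, a < c & c < b].

Definition has_dense (A : set T) := exists2 X, X `<=` A & densely_ordered X.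

Lemma has_dense_sub (A B : set T) : A `<=` B -> has_dense A -> has_dense B.
Proof. by move=> AB [X XA dX]; exists X => //; apply: subset_trans AB. Qed.

Lemma densely_ordered_between X (a b : T) : densely_ordered X ->
  X a -> X b -> a < b -> densely_ordered (X `&` [set z | a < z < b]).
Proof.
move=> [_ dX] Xa Xb ab; have [c [Xc ac cb]] := dX _ _ Xa Xb ab.
have [e [Xe ae ec]] := dX _ _ Xa Xc ac.
split.
  exists e, c; split=> //; split=> //=; first by rewrite ae (lt_trans ec cb).
  by rewrite ac.
move=> u v [Xu /andP[au ub]] [Xv /andP[av vb]] uv.
have [w [Xw uw wv]] := dX _ _ Xu Xv uv.
by exists w; split=> //; split=> //=; rewrite (lt_trans au uw) (lt_trans wv vb).
Qed.

(** Either some interval of [X] misses [A] and so lies in [B], or [A] meets every interval of [X]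
    and [X] remains dense when cut down to [A]. *)
Lemma has_denseU (A B : set T) :
  has_dense (A `|` B) -> has_dense A \/ has_dense B.
Proof.
move=> [X XAB dX].
have [[a [b [Xa Xb ab gap]]]|ngap] := EM (exists a b, [/\ X a, X b, a < b &
    forall z, X z -> a < z -> z < b -> ~ A z]).
  right; exists (X `&` [set z | a < z < b]); last exact: densely_ordered_between.
  by move=> z [Xz /andP[az zb]]; case: (XAB _ Xz) => // /gap; case.
have hit a b : X a -> X b -> a < b -> exists c, [/\ (X `&` A) c, a < c & c < b].
  move=> Xa Xb ab; apply: contrapT => h; apply: ngap; exists a, b; split=> //.
  by move=> z Xz az zb Az; apply: h; exists z.
left; exists (X `&` A); first by move=> z [].
split; last by move=> a b [Xa _] [Xb _]; apply: hit.
case: dX => [[a [b [Xa Xb ab]]] _].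
have [c [[Xc Ac] ac cb]] := hit _ _ Xa Xb ab.
by have [e [XAe ae ec]] := hit _ _ Xa Xc ac; exists e, c.
Qed.

Lemma has_dense0 : ~ has_dense set0.
Proof. by move=> [X X0 [[a [b [Xa _ _]]] _]]; case: (X0 a Xa). Qed.

Lemma has_dense1 (x : T) : ~ has_dense [set x].
Proof. by move=> [X X1 [[a [b [/X1-> /X1-> xx]]] _]]; rewrite ltxx in xx. Qed.

Lemma has_dense_conn (S : set T) y : has_dense (conn S y) ->
  exists2 p, S p & has_dense (S `&` [set z | z >< p]).
Proof.
move=> dy; apply: contrapT => h.
have {}h p : S p -> ~ has_dense (S `&` [set z | z >< p]).
  by move=> Sp hd; apply: h; exists p.
(* Walking from [y] to [z], each step enlarges the part of [S] between [y] and the current vertex by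
   a set without dense subset. *)
have btw z : conn S y z ->
    ~ has_dense (S `&` [set w | (y < w < z) || (z < w < y)]).
  elim=> [Sy|u v yu IH Sv uv].
    apply: contra_not has_dense0; apply: has_dense_sub => w [_] /=.
    by rewrite orbb => /andP[a b]; have := lt_trans a b; rewrite ltxx.
  have Su := conn_sub yu.
  have vu : v >< u by rewrite comparable_sym.
  move=> hd.
  (* An element between [y] and [v] that is comparable to [u] and distinct from it lies between [y]
     and [u], because [u] and [v] are incomparable. *)
  have : has_dense ((S `&` [set w | (y < w < u) || (u < w < y)]) `|`
      ([set u] `|` (S `&` [set z | z >< u]))).
    apply: has_dense_sub hd => w [Sw] /= hw.
    case: (order_cases w u) => [->|wu|uw|wu]; [by right; left| | |by right; right].
    - left; split=> //=; case/orP: hw => /andP[a b]; first by rewrite a wu.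
      by have := lt_trans a wu; rewrite (incomparable_ltF vu).
    - left; split=> //=; case/orP: hw => /andP[a b]; last by rewrite uw b orbT.
      by have := lt_trans uw b; rewrite (incomparable_ltF uv).
  by case/has_denseU => [/IH //|/has_denseU[/has_dense1|/(h _ Su)]].
have Sy : S y by have [X XA [[a [b [/XA/conn_base]]]]] := dy.
have : has_dense ([set y] `|` ((S `&` [set z | z >< y]) `|`
    ((conn S y `&` [set w | y < w]) `|` (conn S y `&` [set w | w < y])))).
  apply: has_dense_sub dy => w yw; have Sw := conn_sub yw.
  case: (order_cases w y) => [->|wy|yw'|wy]; first by left.
  - by right; right; right.
  - by right; right; left.
  - by right; left.
case/has_denseU => [/has_dense1 //|/has_denseU[/(h _ Sy) //|/has_denseU[]]] [X XA dX];
  case: (dX) => [[a [b [Xa Xb ab]]] _];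
  have := densely_ordered_between dX Xa Xb ab => dX'.
(* With [X] above [y], its part between [a] and [b] is dense and lies between [y] and [b], against
   [btw]. *)
- have [/btw hb _] := XA _ Xb; apply: hb; exists (X `&` [set z | a < z < b]) => //.
  move=> z [/XA[yz /= ltyz] /andP[_ zb]]; split; first exact: conn_sub yz.
  by rewrite /= ltyz zb.
- have [/btw ha _] := XA _ Xa; apply: ha; exists (X `&` [set z | a < z < b]) => //.
  move=> z [/XA[yz /= ltyz] /andP[az _]]; split; first exact: conn_sub yz.
  by rewrite /= ltyz az orbT.
Qed.

Lemma has_dense_rat (f : rat -> T) :
  {mono f : x y / x <= y} -> has_dense [set: T].
Proof.
move=> /leW_mono fl; exists (range f) => //; split.
  by exists (f 0%R), (f 1%R); split=> //; rewrite fl ltr01.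
move=> _ _ [a _ <-] [b _ <-]; rewrite fl => ab.
by exists (f ((a + b) / 2)%R); split=> //; rewrite fl midf_lt.
Qed.

End DenselyOrdered.

Theorem theorem1p4 (d : Order.disp_t) (T : porderType d)
    (hI : interval_order T) (hP : prime_poset T)
    (hA : forall A : set T, antichain A -> finite_set A) :
  countable [set: T] /\ scattered T.
Proof.
have T22 := interval_order_2p2_free hI.
split.
  apply: contrapT => nc.
  have [|||||A [/hA]//] :=
    @infinite_antichain _ T T22 (fun A => ~ countable A) _ _ _ _ _ hP nc.
  - by move=> A B AB cA cB; apply: cA; apply: sub_countable cB; apply: subset_card_le.
  - move=> A B nAB; apply: contrapT => /not_orP[/contrapT cA /contrapT cB].
    by apply: nAB; rewrite -bigcup2E; apply: bigcup_countable => // -[|[|]].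
  - by apply; apply: countable0.
  - by move=> x; apply; apply: countable1.
  - exact: uncountable_conn.
(* An embedding of [rat] makes the whole poset large in the second sense. *)
move=> [f fm].
have [A [/hA//]] := infinite_antichain T22 (@has_dense_sub _ T) has_denseU
  has_dense0 has_dense1 has_dense_conn hP (has_dense_rat fm).
Qed.
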